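(* Let $(Co_{\mathbf{K}},i)$ be an equational filter pair over $\Sigma$, with $i$ given by the equations $\delta(x)\approx\epsilon(x)$. Then for every $\Sigma$-structure $A$ the left adjoint $\Xi_A$ of $i_A$ maps $S\subseteq A$ to the $\mathbf{K}$-congruence generated by $\{\langle\delta^A(s),\epsilon^A(s)\rangle\mid s\in S\}$ (with $\delta\approx\epsilon$ ranging over the given equations), i.e. to the smallest element of $Co_{\mathbf{K}}(A)$ containing this set.
   Context: A quasivariety is a class of $\Sigma$-structures axiomatizable by quasi-identities. $Co_{\mathbf{K}}(A)$ is the complete lattice, ordered by inclusion, of congruences $\theta$ on $A$ with $A/\theta\in\mathbf{K}$ ($\mathbf{K}$-congruences). An equational filter pair is a pair $(Co_{\mathbf{K}},i)$ with $\mathbf{K}$ a quasivariety and $i_A:Co_{\mathbf{K}}(A)\to\mathcal{P}(A)$, $i_A(\theta)=\{a\in A\mid\langle\delta^A(a),\epsilon^A(a)\rangle\in\theta$ for all $\delta\approx\epsilon\in\tau\}$ for every $\Sigma$-structure $A$, where $\tau$ is a fixed finite set of equations in at most one variable (''$i$ is given by $\tau$''). Since $i_A$ preserves arbitrary infima it has a left adjoint $\Xi_A:\mathcal{P}(A)\to Co_{\mathbf{K}}(A)$, characterized by $\Xi_A(S)\subseteq\theta\iff S\subseteq i_A(\theta)$. *)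

(* Defs.v *)
From HB Require Import structures.
From mathcomp Require Import all_boot.
From mathcomp Require Import boolp classical_sets functions cardinality.
Set Implicit Arguments.
Unset Strict Implicit.
Unset Printing Implicit Defensive.

Local Open Scope classical_set_scope.
Local Open Scope quotient_scope.

Record signature := Signature {
  symbol :> Type;
  arity : symbol -> nat
}.

(* Carriers are allowed to be empty. *)
Record algebra (Sigma : signature) := Algebra {
  carrier :> Type;
  op : forall f : Sigma, ('I_(arity f) -> carrier) -> carrier
}.

Inductive term (Sigma : signature) (X : Type) : Type :=
| Var of X
| App (f : Sigma) of ('I_(arity f) -> term Sigma X).

Fixpoint eval Sigma (A : algebra Sigma) X (v : X -> A) (t : term Sigma X) : A :=
  match t with
  | Var x => v x
  | App f ts => op (fun i => eval v (ts i))
  end.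

Definition equation Sigma X := (term Sigma X * term Sigma X)%type.

Record quasi_identity Sigma := QuasiIdentity {
  premises : set (equation Sigma nat);
  premises_finite : finite_set premises;
  conclusion : equation Sigma nat
}.

Definition satisfies Sigma (A : algebra Sigma) (q : quasi_identity Sigma) :=
  forall v : nat -> A,
    (forall e, premises q e -> eval v e.1 = eval v e.2) ->
    eval v (conclusion q).1 = eval v (conclusion q).2.

Definition quasivariety Sigma (K : algebra Sigma -> Prop) :=
  exists Q : set (quasi_identity Sigma),
    forall A, K A <-> (forall q, Q q -> satisfies A q).

Record congruence Sigma (A : algebra Sigma) := Congruence {
  cong_set :> set (A * A);
  cong_refl : forall a, cong_set (a, a);
  cong_sym : forall a b, cong_set (a, b) -> cong_set (b, a);
  cong_trans : forall b a c,
    cong_set (a, b) -> cong_set (b, c) -> cong_set (a, c);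
  cong_op : forall (f : Sigma) (a b : 'I_(arity f) -> A),
    (forall i, cong_set (a i, b i)) -> cong_set (op a, op b)
}.

Section Quotient.
Variables (Sigma : signature) (A : algebra Sigma) (theta : congruence A).

Definition cong_rel : rel {classic A} := fun a b => `[< cong_set theta (a, b) >].

Lemma cong_rel_refl : reflexive cong_rel.
Proof. by move=> a; apply/asboolP; exact: cong_refl. Qed.

Lemma cong_rel_sym : symmetric cong_rel.
Proof. by move=> a b; apply/asboolP/asboolP; exact: cong_sym. Qed.

Lemma cong_rel_trans : transitive cong_rel.
Proof.
by move=> b a c /asboolP ab /asboolP bc; apply/asboolP; exact: cong_trans ab bc.
Qed.

Definition cong_equiv : equiv_rel {classic A} :=
  EquivRel cong_rel cong_rel_refl cong_rel_sym cong_rel_trans.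

Definition quotient : algebra Sigma :=
  @Algebra Sigma {eq_quot cong_equiv}
    (fun f a => \pi_({eq_quot cong_equiv}) (op (fun i => repr (a i) : A))).

Definition proj (a : A) : quotient := \pi_({eq_quot cong_equiv}) a.

Lemma projP a b : proj a = proj b <-> cong_set theta (a, b).
Proof.
split; first by move/eqmodP/asboolP.
by move=> ab; apply/eqmodP/asboolP.
Qed.

Lemma proj_repr (c : quotient) : exists a, proj a = c.
Proof. by exists (repr (c : {eq_quot cong_equiv})); exact: reprK. Qed.

Lemma proj_op (f : Sigma) (a : 'I_(arity f) -> A) :
  op (fun i => proj (a i)) = proj (op a).
Proof.
apply/projP; apply: cong_op => i; apply/projP; exact: reprK.
Qed.

Lemma eval_proj X (v : X -> A) (t : term Sigma X) :
  eval (fun x => proj (v x)) t = proj (eval v t).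
Proof.
elim: t => [//|f ts IH].
have /(congr1 (@op _ quotient f)) opE := funext IH.
exact: etrans opE (proj_op _).
Qed.

Lemma quotient_satisfies q : satisfies quotient q <->
  forall v : nat -> A,
    (forall e, premises q e -> cong_set theta (eval v e.1, eval v e.2)) ->
    cong_set theta (eval v (conclusion q).1, eval v (conclusion q).2).
Proof.
split=> [sat v prem|sat v prem].
  apply/projP; rewrite -!eval_proj; apply: sat => e /prem.
  by rewrite !eval_proj => /projP.
have [w wE] := choice (fun n => proj_repr (v n)).
have vE : v = fun n => proj (w n) by apply/funext => n; rewrite wE.
move: prem; rewrite vE => prem; rewrite !eval_proj; apply/projP.
by apply: sat => e /prem; rewrite !eval_proj => /projP.
Qed.

End Quotient.

Record Co Sigma (K : algebra Sigma -> Prop) (A : algebra Sigma) := KCongruence {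
  Co_cong :> congruence A;
  Co_quotient : K (quotient Co_cong)
}.

Definition is_generated_Kcong Sigma (K : algebra Sigma -> Prop) (A : algebra Sigma)
    (X : set (A * A)) (theta : Co K A) :=
  X `<=` theta /\ forall theta' : Co K A, X `<=` theta' -> theta `<=` theta'.

(* Equations in at most one variable are equations over the variable type
   [unit]; this is t^A(a). *)
Definition eval1 Sigma (A : algebra Sigma) (t : term Sigma unit) (a : A) : A :=
  eval (fun=> a) t.

Definition given_by Sigma (K : algebra Sigma -> Prop)
    (i : forall A : algebra Sigma, Co K A -> set A)
    (tau : set (equation Sigma unit)) :=
  forall (A : algebra Sigma) (theta : Co K A),
    i A theta =
    [set a | forall e, tau e -> cong_set theta (eval1 e.1 a, eval1 e.2 a)].

Record equational_filter_pair Sigma := EquationalFilterPair {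
  efp_class : algebra Sigma -> Prop;
  efp_quasivariety : quasivariety efp_class;
  efp_map : forall A : algebra Sigma, Co efp_class A -> set A;
  efp_given : exists2 tau : set (equation Sigma unit),
    finite_set tau & given_by efp_map tau
}.
Arguments efp_map {Sigma} _ A _ _.

Section Infimum.
Variables (Sigma : signature) (K : algebra Sigma -> Prop) (A : algebra Sigma).
Hypothesis Kqv : quasivariety K.
Variable T : set (Co K A).

Definition inf_set : set (A * A) :=
  [set p | forall theta : Co K A, T theta -> cong_set theta p].

Definition inf_cong : congruence A.
Proof.
apply: (@Congruence _ _ inf_set).
- by move=> a theta _; exact: cong_refl.
- by move=> a b ab theta Tt; apply/cong_sym/ab.
- by move=> b a c ab bc theta Tt; apply: cong_trans (ab _ Tt) (bc _ Tt).
- by move=> f a b ab theta Tt; apply: cong_op => i; exact: ab.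
Defined.

Lemma inf_quotient : K (quotient inf_cong).
Proof.
have [Q QP] := Kqv; apply/QP => q Qq; apply/quotient_satisfies.
move=> v prem theta Tt.
have /QP /(_ q Qq) /quotient_satisfies := Co_quotient theta.
by apply=> e /prem; apply.
Qed.

Definition Co_inf : Co K A := KCongruence inf_quotient.

End Infimum.

Section LeftAdjoint.
Variables (Sigma : signature) (F : equational_filter_pair Sigma).
Variable A : algebra Sigma.
Local Notation K := (efp_class F).

Lemma efp_map_inf (T : set (Co K A)) :
  efp_map F A (Co_inf (efp_quasivariety F) T) =
  \bigcap_(theta in T) efp_map F A theta.
Proof.
have [tau _ tauP] := efp_given F; apply/seteqP; split=> a.
  by rewrite tauP => aT theta Tt; rewrite tauP => e te; exact: aT.
rewrite tauP => aT e te theta Tt.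
by have := aT _ Tt; rewrite tauP; apply.
Qed.

Definition is_left_adjoint (Xi : set A -> Co K A) :=
  forall (S : set A) (theta : Co K A),
    (Xi S : set (A * A)) `<=` theta <-> S `<=` efp_map F A theta.

Lemma left_adjoint_exists : exists Xi, is_left_adjoint Xi.
Proof.
pose U (S : set A) := [set theta : Co K A | S `<=` efp_map F A theta].
exists (fun S => Co_inf (efp_quasivariety F) (U S)) => S theta; split.
  have SU : S `<=` efp_map F A (Co_inf (efp_quasivariety F) (U S)).
    by rewrite efp_map_inf => a Sa t; apply.
  have [tau _ tauP] := efp_given F.
  move=> le; apply: subset_trans SU _; rewrite !tauP => a ta e te.
  exact/le/ta.
by move=> Stheta p; apply.
Qed.

Definition left_adjoint : set A -> Co K A := sval (cid left_adjoint_exists).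

Lemma left_adjointP : is_left_adjoint left_adjoint.
Proof. exact: (svalP (cid left_adjoint_exists)). Qed.

Lemma left_adjoint_unique Xi S : is_left_adjoint Xi ->
  Xi S = left_adjoint S :> set (A * A).
Proof.
move=> XiP; apply/seteqP; split.
- by apply/XiP/left_adjointP.
- by apply/left_adjointP/XiP.
Qed.

End LeftAdjoint.
Arguments left_adjoint {Sigma} F A _.

(* Main.v *)
Require Import Defs.
From mathcomp Require Import all_boot.
From mathcomp Require Import boolp classical_sets functions cardinality.
Set Implicit Arguments.
Unset Strict Implicit.
Unset Printing Implicit Defensive.

Local Open Scope classical_set_scope.

Theorem proposition4p2 (Sigma : signature) (F : equational_filter_pair Sigma)
    (tau : set (equation Sigma unit)) (tau_finite : finite_set tau)
    (F_tau : given_by (efp_map F) tau) (A : algebra Sigma) (S : set A) :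
  is_generated_Kcong
    [set p | exists s e, [/\ S s, tau e & p = (eval1 e.1 s, eval1 e.2 s)]]
    (left_adjoint F A S).
Proof.
pose X := [set p | exists s e, [/\ S s, tau e & p = (eval1 e.1 s, eval1 e.2 s)]].
(* The pairs attached to [S] lie in [theta] exactly when [S] lies in [i theta],
   so being generated by these pairs is the universal property of the adjoint. *)
have subE (theta : Co (efp_class F) A) :
    X `<=` theta <-> S `<=` efp_map F A theta.
  (* Unfolding [i] through [tau] turns both sides into the same condition, with [s] in [S] and [e]
     in [tau] quantified in either form. *)
  rewrite F_tau; split=> [Xtheta s Ss e te|Stheta _ [s [e [Ss te ->]]]].
    by apply: Xtheta; exists s, e.
  exact: Stheta.
(* Minimality is the direction of the adjunction from [S] inside [i theta] to the adjoint's value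
   lying below [theta]. *)
split=> [|theta /subE Stheta]; last exact/left_adjointP.
(* Containment is the unit of the adjunction: taking [theta] to be [left_adjoint F A S] itself
   leaves only reflexivity of inclusion. *)
by apply/subE/left_adjointP.
Qed.
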